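(* Let $1\le p<\infty$, let $\mathcal{X}$ be a Banach space and $\mathcal{M}\subseteq\mathcal{X}$ a non-empty subset. A pair $(\{f_n\}_n,\{\tau_n\}_n)$ is a Lipschitz p-ASF for $\mathcal{M}$ if and only if $$f_n=\zeta_nU,\qquad \tau_n=Ve_n,\qquad\forall n\in\mathbb{N},$$ where $U:\mathcal{M}\to\ell^p(\mathbb{N})$ is a Lipschitz map and $V:\ell^p(\mathbb{N})\to\mathcal{X}$ is a bounded linear operator such that $VU(\mathcal{M})\subseteq\mathcal{M}$, $Ve_n\in\mathcal{M}$ for all $n\in\mathbb{N}$, $VU:\mathcal{M}\to\mathcal{M}$ is an invertible bi-Lipschitz map, and $$x=\sum_{n=1}^\infty\zeta_n(Ux)\,(VU)^{-1}Ve_n,\qquad\forall x\in\mathcal{M}.$$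
   Context: Let $\mathcal{X}$ be a real or complex Banach space with scalar field $\mathbb{K}$, $\mathcal{M}$ a non-empty subset of $\mathcal{X}$ (not necessarily a subspace), and $1\le p<\infty$. $\{e_n\}_n$ is the canonical Schauder basis of $\ell^p(\mathbb{N})$ and $\{\zeta_n\}_n$ its coordinate functionals. $\operatorname{Lip}(\mathcal{M},\mathbb{K})$ is the set of Lipschitz functions from $\mathcal{M}$ to $\mathbb{K}$. A map $T$ between subsets of normed spaces is bi-Lipschitz if there are $a,b>0$ with $a\|x-y\|\le\|Tx-Ty\|\le b\|x-y\|$ for all $x,y$. Juxtaposition of maps denotes composition. Definition. Let $\{\tau_n\}_n$ be a sequence in $\mathcal{M}$ and $\{f_n\}_n$ a sequence in $\operatorname{Lip}(\mathcal{M},\mathbb{K})$. The pair $(\{f_n\}_n,\{\tau_n\}_n)$ is a Lipschitz p-approximate Schauder frame (Lipschitz p-ASF) for $\mathcal{M}$ if: (1) the analysis map $\theta_f:\mathcal{M}\ni x\mapsto\{f_n(x)\}_n\in\ell^p(\mathbb{N})$ is a well-defined Lipschitz map; (2) the synthesis operator $\theta_\tau:\ell^p(\mathbb{N})\ni\{a_n\}_n\mapsto\sum_{n=1}^\infty a_n\tau_n\in\mathcal{X}$ is a well-defined bounded linear operator; (3) the Lipschitz frame map $S_{f,\tau}:\mathcal{M}\ni x\mapsto\sum_{n=1}^\infty f_n(x)\tau_n\in\mathcal{M}$ is a well-defined invertible (bijective) bi-Lipschitz map, and $x=\sum_{n=1}^\infty f_n(x)S_{f,\tau}^{-1}\tau_n$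 for all $x\in\mathcal{M}$. *)

(* Defs.v *)
From HB Require Import structures.
From mathcomp Require Import all_boot all_order all_algebra.
From mathcomp Require Import complex.
From mathcomp Require Import all_classical all_reals all_analysis.

Set Implicit Arguments.
Unset Strict Implicit.
Unset Printing Implicit Defensive.

Import Order.TTheory GRing.Theory Num.Theory.
Import numFieldNormedType.Exports.

Local Open Scope classical_set_scope.
Local Open Scope ring_scope.

Variant scalar_kind := RealScalars | ComplexScalars.

Definition scalars (R : realType) (k : scalar_kind) : numFieldType :=
  match k with RealScalars => R | ComplexScalars => R[i] end.

(* The norm of a [normedModType K] takes its values in [K] itself, also for
   [K = R[i]].  [modulus] is the real number underlying the absolute value of
   a scalar, and [of_real] embeds the real numbers into the scalars. *)
Definition modulus (R : realType) (k : scalar_kind) : scalars R k -> R :=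
  match k with
  | RealScalars => fun x : R => `|x|
  | ComplexScalars => fun z : R[i] => complex.Re `|z|
  end.

Definition of_real (R : realType) (k : scalar_kind) : R -> scalars R k :=
  match k with
  | RealScalars => id
  | ComplexScalars => real_complex R
  end.
Arguments of_real {R} k _.

Section ScalarTheory.
Context (R : realType) (k : scalar_kind).
Implicit Types (x y : scalars R k) (a b : R).

Lemma normr_modulus x : `|x| = of_real k (modulus x).
Proof. by case: k x => //= x; rewrite RRe_real ?normr_real. Qed.

Lemma of_realD a b : of_real k (a + b) = of_real k a + of_real k b.
Proof. by case: k => //=; rewrite rmorphD. Qed.

Lemma of_realM a b : of_real k (a * b) = of_real k a * of_real k b.
Proof. by case: k => //=; rewrite rmorphM. Qed.

Lemma of_real0 : of_real k 0 = 0 :> scalars R k.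
Proof. by case: k. Qed.

Lemma ler_of_real a b : (of_real k a <= of_real k b) = (a <= b).
Proof. by case: k => //=; rewrite lecR. Qed.

Lemma of_real_inj : injective (@of_real R k).
Proof. by move=> a b /eqP; rewrite eq_le !ler_of_real -eq_le => /eqP. Qed.

Lemma modulus_ge0 x : 0 <= modulus x.
Proof. by rewrite -ler_of_real of_real0 -normr_modulus. Qed.

Lemma modulus0 : modulus (0 : scalars R k) = 0.
Proof. by apply: of_real_inj; rewrite -normr_modulus normr0 of_real0. Qed.

Lemma modulus0_eq0 x : modulus x = 0 -> x = 0.
Proof.
by move=> x0; apply/normr0_eq0; rewrite normr_modulus x0 of_real0.
Qed.

Lemma modulusM x y : modulus (x * y) = modulus x * modulus y.
Proof.
by apply: of_real_inj; rewrite of_realM -!normr_modulus normrM.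
Qed.

Lemma ler_modulusD x y : modulus (x + y) <= modulus x + modulus y.
Proof.
by rewrite -ler_of_real of_realD -!normr_modulus ler_normD.
Qed.

End ScalarTheory.

Section LpSeq.
Context (R : realType) (k : scalar_kind) (p : R).

Definition lp_sum (a : nat -> scalars R k) : \bar R :=
  (\sum_(n <oo) (modulus (a n) `^ p)%:E)%E.

Definition lp_norm (a : nat -> scalars R k) : R := fine (lp_sum a) `^ p^-1.

Definition lp_summable : {pred nat -> scalars R k} :=
  fun a => (lp_sum a < +oo)%E.

Lemma lp_sum_ge0 a : (0 <= lp_sum a)%E.
Proof. by apply: nneseries_ge0 => n _ _; rewrite lee_fin powR_ge0. Qed.

Let cmod (a : nat -> scalars R k) : nat -> R := fun n => modulus (a n).

Hypothesis p1 : 1 <= p.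

Let p_gt0 : 0 < p. Proof. exact: lt_le_trans p1. Qed.

Lemma Lnorm_lp_sum a :
  (Lnorm counting p%:E (EFin \o cmod a) = lp_sum a `^ p^-1)%E.
Proof.
rewrite Lnorm_counting//; congr poweR; apply: eq_eseriesr => n _ /=.
by rewrite ger0_norm ?modulus_ge0.
Qed.

Lemma lp_summableE a :
  (a \in lp_summable) = (Lnorm counting p%:E (EFin \o cmod a) < +oo)%E.
Proof.
rewrite Lnorm_lp_sum; have := lp_sum_ge0 a.
by rewrite unfold_in /lp_summable; case: (lp_sum a) => //= [r|] _;
  rewrite ?ltry//= gt_eqF// invr_gt0.
Qed.

Lemma lp_normE a : a \in lp_summable ->
  (Lnorm counting p%:E (EFin \o cmod a) = (lp_norm a)%:E)%E.
Proof.
rewrite Lnorm_lp_sum unfold_in /lp_summable /lp_norm; have := lp_sum_ge0 a.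
by case: (lp_sum a).
Qed.

Lemma lp_minkowski a b :
  (Lnorm counting p%:E (EFin \o cmod (a + b)%R) <=
   Lnorm counting p%:E (EFin \o cmod a) +
   Lnorm counting p%:E (EFin \o cmod b))%E.
Proof.
have mcmod f : measurable_fun [set: nat] (cmod f) by [].
apply: le_trans (minkowski_EFin counting (mcmod a) (mcmod b) p1).
rewrite !Lnorm_counting//; apply: gt0_ler_poweR.
- by rewrite invr_ge0 ltW.
- by rewrite in_itv/= leey nneseries_ge0// => *; rewrite poweR_ge0.
- by rewrite in_itv/= leey nneseries_ge0// => *; rewrite poweR_ge0.
apply: lee_nneseries => [n _ _|n _]; first by rewrite poweR_ge0.
rewrite /= lee_fin ge0_ler_powR ?nnegrE ?(ltW p_gt0)//.
by rewrite !ger0_norm ?addr_ge0 ?modulus_ge0// ler_modulusD.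
Qed.

Lemma ler_lp_norm a b :
  a \in lp_summable -> b \in lp_summable -> a + b \in lp_summable ->
  lp_norm (a + b) <= lp_norm a + lp_norm b.
Proof.
move=> /lp_normE la /lp_normE lb /lp_normE lab.
have eq_leD (x y z x' y' z' : \bar R) :
  x = x' -> y = y' -> z = z' -> (x <= y + z -> x' <= y' + z')%E.
  by move=> -> -> ->.
rewrite -lee_fin EFinD.
exact: (eq_leD _ _ _ _ _ _ lab la lb (lp_minkowski a b)).
Qed.

Lemma lp_sumZ c a : lp_sum (c *: a) = ((modulus c `^ p)%:E * lp_sum a)%E.
Proof.
rewrite /lp_sum -nneseriesZl; last by move=> n _; rewrite lee_fin powR_ge0.
apply: eq_eseriesr => n _.
by rewrite -EFinM -powRM ?modulus_ge0// -modulusM.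
Qed.

Lemma lp_sum0 : lp_sum 0 = 0%E.
Proof.
by rewrite /lp_sum eseries0// => n _ _; rewrite modulus0 powR0// gt_eqF.
Qed.

Lemma lp_submod_closed : submod_closed lp_summable.
Proof.
split; first by rewrite unfold_in /lp_summable lp_sum0 ltry.
move=> c a b la lb; rewrite lp_summableE (le_lt_trans (lp_minkowski _ _))//.
rewrite lte_add_pinfty -?lp_summableE//.
move: la; rewrite !unfold_in /lp_summable lp_sumZ => la.
by rewrite lte_mul_pinfty ?lee_fin ?powR_ge0.
Qed.

(* Mentioning [p1] lets the closure instance below, which needs [1 <= p], be
   found by unification. *)
Definition lp_closed : {pred nat -> scalars R k} := let _ := p1 in lp_summable.

HB.instance Definition _ :=
  GRing.isSubmodClosed.Build _ _ lp_closed lp_submod_closed.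

Record lp : Type := Lp {
  lp_seq :> nat -> scalars R k ;
  _ : lp_seq \in lp_closed
}.

HB.instance Definition _ := [isSub for lp_seq].
HB.instance Definition _ := [Choice of lp by <:].
HB.instance Definition _ := [SubChoice_isSubLmodule of lp by <:].

Lemma lp_seqP (a : lp) : lp_seq a \in lp_summable.
Proof. by case: a. Qed.

Definition lp_normr (a : lp) : scalars R k := of_real k (lp_norm a).

Lemma ler_lp_normD a b : lp_normr (a + b) <= lp_normr a + lp_normr b.
Proof.
rewrite -of_realD ler_of_real.
exact: (ler_lp_norm (lp_seqP a) (lp_seqP b) (lp_seqP (a + b))).
Qed.

Lemma lp_normrZ c a : lp_normr (c *: a) = `|c| * lp_normr a.
Proof.
rewrite normr_modulus -of_realM; congr of_real.
rewrite /lp_norm lp_sumZ fineM//; last first.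
  by rewrite ge0_fin_numE ?lp_sum_ge0//; exact: lp_seqP.
rewrite /= powRM ?powR_ge0 ?fine_ge0 ?lp_sum_ge0//.
by rewrite -powRrM divff ?gt_eqF// powRr1// modulus_ge0.
Qed.

Lemma lp_normr_eq0 a : lp_normr a = 0 -> a = 0.
Proof.
rewrite -(of_real0 R k) => /of_real_inj /eqP; rewrite powR_eq0.
rewrite fine_eq0; last by rewrite ge0_fin_numE ?lp_sum_ge0//; exact: lp_seqP.
move=> /andP[/eqP a0 _]; apply/val_inj/funext => n /=.
apply/modulus0_eq0/eqP; apply: contraT => an0.
have : (0 < lp_sum a)%E.
  apply: (@lt_le_trans _ _ (modulus (a n) `^ p)%:E).
    by rewrite lte_fin powR_gt0// lt_neqAle eq_sym an0 modulus_ge0.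
  rewrite /lp_sum (@nneseriesD1 _ _ n)//=.
    by rewrite leeDl// nneseries_ge0// => *; rewrite lee_fin powR_ge0.
  by move=> *; rewrite lee_fin powR_ge0.
by rewrite a0 ltxx.
Qed.

HB.instance Definition _ :=
  Lmodule_isNormed.Build (scalars R k) lp ler_lp_normD lp_normrZ lp_normr_eq0.

Lemma lp_basis_closed n :
  (fun m : nat => (m == n)%:R : scalars R k) \in lp_closed.
Proof.
rewrite unfold_in /lp_closed /lp_summable /lp_sum.
rewrite (@nneseries_split _ _ 0 n.+1); last first.
  by move=> m _; rewrite lee_fin powR_ge0.
rewrite add0n eseries0 ?adde0; last first.
  by move=> m nm _; rewrite gtn_eqF// modulus0 powR0// gt_eqF.
by rewrite sumEFin ltry.
Qed.

Definition lp_basis (n : nat) : lp := Lp (lp_basis_closed n).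

Definition lp_coord (n : nat) (a : lp) : scalars R k := a n.

End LpSeq.
Arguments lp {R} k {p} p1.
Arguments lp_closed {R} k {p} p1.
Arguments lp_basis {R} k {p} p1 n.
Arguments lp_coord {R k p p1} n a.

Section LipschitzASF.
Context (R : realType) (k : scalar_kind) (p : R) (p1 : 1 <= p).
Local Notation K := (scalars R k).

Definition bounded_linear (V W : normedModType K) (T : V -> W) : Prop :=
  linear T /\ exists C : K, forall v, `|T v| <= C * `|v|.

Definition bilipschitz_on (V W : normedModType K) (A : set V) (T : V -> W) :
    Prop :=
  exists a b : K, [/\ 0 < a, 0 < b &
    forall x y, A x -> A y ->
      a * `|x - y| <= `|T x - T y| /\ `|T x - T y| <= b * `|x - y|].

Context (X : completeNormedModType K).
Implicit Types (M : set X) (f : nat -> X -> K) (tau : nat -> X).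

(* Maps defined on a subset [M] of [X] are represented by total maps, all of
   whose properties are required on [M] only.  The three maps below take junk
   values where the family is not in l^p or the series does not converge;
   [lipschitz_pASF] excludes these cases by its [_def] clauses.  Since
   [frame_map f tau] is a bijection of [M], its inverse is the partial inverse
   ['pinv_(fun=> 0) M (frame_map f tau)]. *)
Definition analysis f (x : X) : lp k p1 := insubd 0 (fun n => f n x).

Definition synthesis tau (a : lp k p1) : X :=
  limn (series (fun n => lp_coord n a *: tau n)).

Definition frame_map f tau (x : X) : X :=
  limn (series (fun n => f n x *: tau n)).

Record lipschitz_pASF M f tau : Prop := LipschitzPASF {
  pASF_tau : forall n, M (tau n) ;
  pASF_lipschitz : forall n, [lipschitz f n x | x in M] ;
  pASF_analysis_def : forall x, M x -> (fun n => f n x) \in lp_closed k p1 ;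
  pASF_analysis_lipschitz : [lipschitz analysis f x | x in M] ;
  pASF_synthesis_def : forall a : lp k p1,
    cvgn (series (fun n => lp_coord n a *: tau n)) ;
  pASF_synthesis_bounded : bounded_linear (synthesis tau) ;
  pASF_frame_def : forall x, M x -> cvgn (series (fun n => f n x *: tau n)) ;
  pASF_frame_bij : set_bij M M (frame_map f tau) ;
  pASF_frame_bilipschitz : bilipschitz_on M (frame_map f tau) ;
  pASF_reconstruction : forall x, M x ->
    series (fun n => f n x *: 'pinv_(fun=> 0) M (frame_map f tau) (tau n))
      @ \oo --> x
}.

End LipschitzASF.

(* Main.v *)
(* The canonical unit vectors form a Schauder basis of l^p, so a bounded linear
   operator on l^p is the synthesis operator of the images of the unit vectors.
   Hence V is the synthesis operator, U is the analysis map on M, and V o U is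
   the frame map on M.  As total functions these maps may differ outside M, so
   their partial inverses are compared only at points of the image of M. *)
Require Import Defs.
From HB Require Import structures.
From mathcomp Require Import all_boot all_order all_algebra.
From mathcomp Require Import complex.
From mathcomp Require Import all_classical all_reals all_analysis.

Import Order.TTheory GRing.Theory Num.Theory.
Import numFieldNormedType.Exports.

Local Open Scope classical_set_scope.
Local Open Scope ring_scope.

(** Agreement on [A] makes [g] injective there too, so at a point of the image both partial inverses
    return its unique preimage in [A]. *)
Lemma eq_pinv {T U : Type} {dflt : U -> T} {A : set T} {f g : T -> U} {y : U} :
  {in A, f =1 g} -> {in A &, injective f} -> (f @` A) y ->
  'pinv_dflt A f y = 'pinv_dflt A g y.
Proof.
move=> fg finj [x Ax <-].
have ginj : {in A &, injective g}.
  by move=> u v uA vA; rewrite -!fg//; exact: finj.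
have xA : x \in A by rewrite inE.
by rewrite pinvKV// fg// pinvKV.
Qed.

(** By linearity the bound applies to the differences [v - u n], which gives sequential
    continuity. *)
Lemma bounded_linear_cvg {R : realType} {k : scalar_kind}
    {V W : normedModType (scalars R k)} {T : V -> W} :
  bounded_linear T ->
  forall (u : nat -> V) (v : V), u @ \oo --> v -> T \o u @ \oo --> T v.
Proof.
move=> [Tlin [C TC]] u v /cvgrPdist_lt uv.
pose T' : {linear V -> W} := HB.pack T (GRing.isLinear.Build _ _ _ _ T Tlin).
(* The scalar [C] itself need not be positive. Since [C * |w|] dominates a norm, it equals its own
   absolute value [|C| * |w|]; adding 1 gives a strictly positive constant to divide by. *)
have TC' w : `|T w| <= (`|C| + 1) * `|w|.
  apply: (@le_trans _ _ (`|C| * `|w|)); last by rewrite ler_wpM2r// lerDl.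
  have Cw : 0 <= C * `|w| by exact: le_trans (TC w).
  by rewrite -[in leRHS]normr_id -normrM ger0_norm.
have C0 : 0 < `|C| + 1 by rewrite ltr_wpDl.
apply/cvgrPdist_lt => e e0.
have := uv (e / (`|C| + 1)) (divr_gt0 e0 C0).
apply: filterS => n; rewrite ltr_pdivlMr// mulrC => une.
by apply: le_lt_trans une; rewrite /= -[T]/(T' : V -> W) -linearB TC'.
Qed.

Section LpBasis.
Context {R : realType} {k : scalar_kind} {p : R} {p1 : 1 <= p}.
Local Notation K := (scalars R k).
Implicit Types a b : lp k p1.

Lemma lp_coordB n a b : lp_coord n (a - b) = lp_coord n a - lp_coord n b.
Proof. by []. Qed.

(** One term of a nonnegative series is at most its sum. This makes each coordinate functional
    1-Lipschitz. *)
Lemma ler_lp_coord n a : `|lp_coord n a| <= `|a|.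
Proof.
have p0 : 0 < p by exact: lt_le_trans p1.
rewrite normr_modulus [leRHS]/(lp_normr a) ler_of_real /lp_norm.
(* The left side is written as [(|a_n|^p)^(1/p)], so that only the p-th powers remain to be
   compared. *)
rewrite -[leLHS]powRr1 ?modulus_ge0// -(divff (lt0r_neq0 p0)) powRrM.
have afin : lp_sum p a \is a fin_num.
  by rewrite ge0_fin_numE ?lp_sum_ge0//; exact: lp_seqP.
rewrite ge0_ler_powR ?nnegrE ?invr_ge0 ?(ltW p0) ?powR_ge0 ?fine_ge0
  ?lp_sum_ge0//.
rewrite -lee_fin fineK// /lp_sum (@nneseriesD1 _ _ n)//=.
  by rewrite leeDl// nneseries_ge0// => *; rewrite lee_fin powR_ge0.
by move=> *; rewrite lee_fin powR_ge0.
Qed.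

Lemma lp_coord_partial_sum m n a :
  lp_coord m (series (fun i => lp_coord i a *: lp_basis k p1 i) n : lp k p1) =
  if (m < n)%N then lp_coord m a else 0.
Proof.
rewrite /series /=; elim: n => [|n IHn]; first by rewrite big_geq.
rewrite big_nat_recr//=.
transitivity (lp_coord m (\sum_(0 <= i < n) lp_coord i a *: lp_basis k p1 i) +
  lp_coord n a * (m == n)%:R); first by [].
rewrite IHn [in RHS]ltnS [in RHS]leq_eqVlt; case: (ltngtP m n) => [_|_|->] /=.
- by rewrite mulr0 addr0.
- by rewrite mulr0 addr0.
- by rewrite mulr1 add0r.
Qed.

(** Subtracting the partial sum kills the coordinates below [n] and keeps the others; the vanishing
    terms contribute [0^p = 0] because [p > 0]. *)
Lemma lp_sum_tail n a :
  lp_sum p (lp_seq (a - series (fun i => lp_coord i a *: lp_basis k p1 i) n)) =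
  (\sum_(n <= i <oo) (modulus (a i) `^ p)%:E)%E.
Proof.
have p0 : 0 < p by exact: lt_le_trans p1.
set s := series _ n.
have E i : lp_seq (a - s) i = if (i < n)%N then 0 else a i.
  transitivity (lp_coord i a - lp_coord i s); first by [].
  by rewrite lp_coord_partial_sum; case: ifP; rewrite ?subrr ?subr0.
rewrite [RHS]eseries_cond eseries_mkcond; apply: eq_eseriesr => i _.
by rewrite E ltnNge; case: leqP => //= _; rewrite modulus0 powR0// gt_eqF.
Qed.

(** The p-th power of the distance to a partial sum is a tail of a convergent series, hence tends to
    0. *)
Lemma lp_basis_expansion a :
  series (fun i => lp_coord i a *: lp_basis k p1 i) @ \oo --> a.
Proof.
have p0 : 0 < p by exact: lt_le_trans p1.
apply/cvgrPdist_le => e e0.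
(* The tolerance [e] is a scalar, possibly complex; being positive, it comes from a positive real
   [d]. *)
have [d d0 ed] : exists2 d : R, 0 < d & of_real k d = e.
  exists (modulus e); last by rewrite -normr_modulus gtr0_norm.
  rewrite lt_neqAle modulus_ge0 andbT eq_sym; apply/eqP => /modulus0_eq0 e0'.
  by rewrite e0' ltxx in e0.
(* The tail is made smaller than [d^p], whose p-th root is [d]. *)
have := @nneseries_tail_cvg R (fun i => (modulus (a i) `^ p)%:E) xpredT
  (lp_seqP a) (fun _ _ => powR_ge0 _ _).
move=> /fine_cvgP[tfin /cvgrPdist_le /(_ _ (powR_gt0 p d0))].
apply: filterS => n; rewrite sub0r normrN /= => tn.
rewrite [leLHS]/(lp_normr _) -ed ler_of_real /lp_norm lp_sum_tail.
rewrite -[leRHS]powRr1 ?(ltW d0)// -(divff (lt0r_neq0 p0)) powRrM.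
have t0 : (0 <= \sum_(n <= i <oo) (modulus (a i) `^ p)%:E)%E.
  by apply: nneseries_ge0 => *; rewrite lee_fin powR_ge0.
rewrite ge0_ler_powR ?nnegrE ?invr_ge0 ?(ltW p0) ?powR_ge0 ?fine_ge0//.
exact: le_trans (ler_norm _) tn.
Qed.

Context {X : completeNormedModType K}.

(** Continuity carries the basis expansion of [a] through [V], and linearity rewrites the image of
    each partial sum. *)
Lemma bounded_linear_series (V : lp k p1 -> X) a : bounded_linear V ->
  series (fun i => lp_coord i a *: V (lp_basis k p1 i)) @ \oo --> V a.
Proof.
move=> Vbl; have := bounded_linear_cvg Vbl _ _ (lp_basis_expansion a).
have [Vlin _] := Vbl.
pose V' : {linear lp k p1 -> X} :=
  HB.pack V (GRing.isLinear.Build _ _ _ _ V Vlin).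
apply: cvg_trans; apply: near_eq_cvg; apply: nearW => n.
rewrite /series /= -[V]/(V' : lp k p1 -> X) linear_sum.
by apply: eq_bigr => i _; rewrite linearZ.
Qed.

Lemma synthesis_basis (tau : nat -> X) n :
  synthesis tau (lp_basis k p1 n) = tau n.
Proof.
apply: cvg_lim; first exact: norm_hausdorff.
(* From index [n.+1] on, the partial sums contain the term [tau n] and otherwise only zeros. *)
apply: cvg_near_cst; exists n.+1 => // m /= nm.
rewrite /series /= (bigD1_seq n) ?mem_index_iota ?iota_uniq//=.
rewrite /lp_coord /= eqxx scale1r big1 ?addr0// => i /negbTE ->.
by rewrite scale0r.
Qed.

End LpBasis.

Theorem theorem2p6 (R : realType) (k : scalar_kind) (p : R) (p1 : 1 <= p)
    (X : completeNormedModType (scalars R k)) (M : set X) (M0 : M !=set0)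
    (f : nat -> X -> scalars R k) (tau : nat -> X) :
  lipschitz_pASF p1 M f tau <->
  exists (U : X -> lp k p1) (V : lp k p1 -> X),
    [/\ forall n x, M x -> f n x = lp_coord n (U x),
        forall n, tau n = V (lp_basis k p1 n),
        [lipschitz U x | x in M] &
        bounded_linear V] /\
    [/\ forall x, M x -> M (V (U x)),
        forall n, M (V (lp_basis k p1 n)),
        set_bij M M (V \o U),
        bilipschitz_on M (V \o U) &
        forall x, M x ->
          series (fun n => lp_coord n (U x) *:
                    'pinv_(fun=> 0) M (V \o U) (V (lp_basis k p1 n)))
            @ \oo --> x].
Proof.
split=> [[Mtau flip fdef Ulip Vdef Vbl Sdef Sbij Sbilip rec]|].
  (* On [M], p-summability rules out the default value 0 of [analysis]. *)
  have fE n x : M x -> f n x = lp_coord n (analysis p1 f x).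
    by move=> Mx; rewrite /analysis /lp_coord insubdK//; exact: fdef.
  have SE : {in M, frame_map f tau =1 synthesis tau \o analysis p1 f}.
    move=> x; rewrite inE => Mx; rewrite /frame_map /synthesis /=.
    by under eq_fun do rewrite fE//.
  exists (analysis p1 f), (synthesis tau).
  have eS x : M x -> frame_map f tau x = synthesis tau (analysis p1 f x).
    by move=> Mx; apply: SE; rewrite inE.
  have [Sfun Sinj Ssurj] := Sbij.
  split; first by split => // n; rewrite synthesis_basis.
  split.
  - by move=> x Mx; rewrite -eS//; exact: Sfun.
  - by move=> n; rewrite synthesis_basis.
  - exact: eq_set_bijRL SE Sbij.
  - have [c [d [c0 d0 cd]]] := Sbilip.
    by exists c, d; split => // x y Mx My /=; rewrite -!eS//; exact: cd.
  - move=> x Mx; have := rec x Mx.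
    apply: cvg_trans; apply: near_eq_cvg; apply: nearW => n.
    apply: eq_bigr => i _; rewrite fE// synthesis_basis.
    (* Each [tau i] lies in [M], hence in the image of [M] by surjectivity, where the two inverses
       agree. *)
    by rewrite (eq_pinv SE)//; exact: Ssurj.
move=> [U [V [[fE tauE Ulip Vbl] [VUM VM VUbij VUbilip rec]]]].
have Vser a : series (fun n => lp_coord n a *: tau n) @ \oo --> V a.
  under eq_fun do rewrite tauE.
  exact: bounded_linear_series.
(* The equality holds on all of l^p, so boundedness of [V] passes directly to the synthesis
   operator. *)
have VE : synthesis tau = V.
  by apply/funext => a; apply: cvg_lim => //; exact: norm_hausdorff.
have UE x : M x -> (fun n => f n x) = lp_seq (U x).
  by move=> Mx; apply/funext => n; rewrite fE.
have fdef x : M x -> (fun n => f n x) \in lp_closed k p1.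
  by move=> Mx; rewrite UE//; exact: lp_seqP.
have aE x : M x -> analysis p1 f x = U x.
  move=> Mx; apply/val_inj; rewrite /analysis insubdK; first exact: UE.
  exact: fdef.
have Sser x : M x -> series (fun n => f n x *: tau n) @ \oo --> V (U x).
  by move=> Mx; under eq_fun do rewrite fE//; exact: Vser.
have eS x : M x -> frame_map f tau x = V (U x).
  by move=> Mx; apply: cvg_lim; [exact: norm_hausdorff|exact: Sser].
have SE : {in M, V \o U =1 frame_map f tau}.
  by move=> x; rewrite inE => Mx; rewrite eS.
have [VUfun VUinj VUsurj] := VUbij.
split.
- by move=> n; rewrite tauE.
(* Coordinates being 1-Lipschitz, every Lipschitz constant of [U] also serves for [f n]. *)
- move=> n; move: Ulip; rewrite /lipschitz_on; apply: filterS.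
  move=> c Uc [x y] [/= Mx My].
  apply: le_trans (Uc (x, y) (conj Mx My)) => /=.
  by rewrite !fE// -lp_coordB ler_lp_coord.
- exact: fdef.
- move: Ulip; rewrite /lipschitz_on; apply: filterS => c Uc [x y] [/= Mx My].
  by rewrite !aE//; exact: (Uc (x, y) (conj Mx My)).
- by move=> a; apply/cvg_ex; exists (V a); exact: Vser.
- by rewrite VE.
- by move=> x Mx; apply/cvg_ex; exists (V (U x)); exact: Sser.
- exact: eq_set_bijRL SE VUbij.
- have [c [d [c0 d0 cd]]] := VUbilip.
  by exists c, d; split => // x y Mx My; rewrite !eS//; exact: cd.
- move=> x Mx; have := rec x Mx.
  apply: cvg_trans; apply: near_eq_cvg; apply: nearW => n.
  apply: eq_bigr => i _; rewrite fE// -tauE (eq_pinv SE)//.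
  by rewrite tauE; exact: VUsurj.
Qed.
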